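(* Let $n\ge1$ and let $T\in \mathrm{T}_{n-1}$. The order $(\mathfrak S_n,\le_T)$ is a refinement of the right weak order and a coarsening of the Bruhat order, i.e. for all $v,w\in\mathfrak S_n$, $$v\le_R w\implies v\le_T w\implies v\le w,$$ where $\le_R$ is the right weak order and $\le$ is the Bruhat order on $\mathfrak S_n$.
   Context: Permutations $w\in\mathfrak S_n$ are written as words $w=w_1\cdots w_n$. The inversion set of $w$ is the set of pairs of values $(i,j)$, $1\le i<j\le n$, such that $j$ appears before $i$ in $w$. The right weak order is: $v\le_R w$ iff the inversion set of $v$ is contained in that of $w$ (covers exchange the values in two adjacent positions). The Bruhat order $\le$ is the usual one. The poset $\mathcal P_n$ is the set of pairs of integers $(i,j)$ with $1\le i<j\le n$, ordered by $(i_1,j_1)\le(i_2,j_2)$ iff $i_2\le i_1$ and $j_1\le j_2$. For $\sigma=\sigma_1\cdots\sigma_{n-1}\in\mathfrak S_{n-1}$ and $1\le k\le n-1$ let $$\mathcal R_{\sigma,k}=\{x\in\mathcal P_n:\ (k,k+1)\le x\ \text{and}\ (\sigma_\ell,\sigma_\ell+1)\not\le x\ \text{for all}\ \ell<\sigma^{-1}(k)\}.$$ These sets partition $\mathcal P_n$; each gets the order induced from $\mathcal P_n$, and $\mathcal R_\sigma$ is the disjoint union of the posets $\mathcal R_{\sigma,k}$. $\mathrm T_{n-1}$ is the set of binary trees with internal nodes labelled $1,\dots,n-1$ in in-order. The binary search tree of $\sigma$ has root $\sigma_1$, and its left (resp. right) subtree is the binary search tree of the subword of $\sigma$ of values smaller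 (resp. greater) than $\sigma_1$. Every $T\in \mathrm T_{n-1}$ is the binary search tree of some $\sigma\in\mathfrak S_{n-1}$, and $\mathcal R_\sigma$, $\mathcal R_{\sigma,k}$ depend only on $T$; they are written $\mathcal R_T$, $\mathcal R_{T,k}$. Let $(i_{T,k},j_{T,k})$ be the maximum of $\mathcal R_{T,k}$. For $w\in\mathfrak S_n$ let $w^{L,k}$ (resp. $w^{R,k}$) be the subword of $w$ of values in $[i_{T,k},k]$ (resp. in $[k+1,j_{T,k}]$). Then $I_T(w)\subset\mathcal R_T$ is the set such that, for all $1\le k\le n-1$, $i_{T,k}\le i\le k$, $k+1\le j\le j_{T,k}$: $(i,j)\in I_T(w)$ iff the value $w^{L,k}_{i-i_{T,k}+1}$ appears after the value $w^{R,k}_{j-k}$ in $w$. The partial order $\le_T$ on $\mathfrak S_n$ is $v\le_T w$ iff $I_T(v)\subset I_T(w)$. *)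

(* Defs.v *)
From mathcomp Require Import all_boot all_fingroup.

Set Implicit Arguments.
Unset Strict Implicit.
Unset Printing Implicit Defensive.

(* Letters, positions in the poset and node labels are natural numbers counted
   from 1, whereas 'S_n acts on {0, ..., n-1}: [word] shifts the values by 1. *)
Definition word (n : nat) (w : 'S_n) : seq nat :=
  [seq (val (w p)).+1 | p <- enum 'I_n].

(* Meaningful only when [u] and [v] both occur in [s]. *)
Definition before (s : seq nat) (u v : nat) : bool := index u s < index v s.

Definition P (n : nat) : seq (nat * nat) :=
  [seq x <- allpairs pair (iota 1 n) (iota 1 n) | x.1 < x.2].

Definition leP_n (x y : nat * nat) : bool := (y.1 <= x.1) && (x.2 <= y.2).

Definition inversions (n : nat) (w : 'S_n) : seq (nat * nat) :=
  [seq x <- P n | before (word w) x.2 x.1].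

Definition weak_le (n : nat) (v w : 'S_n) : Prop :=
  {subset inversions v <= inversions w}.

(* [tperm a b * v] is the word of v with its letters at positions a and b
   exchanged, since (s * t) p = t (s p). *)
Definition bruhat_step (n : nat) : rel 'S_n := fun v w =>
  [exists a, exists b, w == (tperm a b * v)%g]
  && (size (inversions v) < size (inversions w)).

Definition bruhat_le (n : nat) (v w : 'S_n) : bool :=
  connect (@bruhat_step n) v w.

Inductive bintree : Type :=
| Leaf
| Node of bintree & nat & bintree.

Fixpoint inorder (T : bintree) : seq nat :=
  if T is Node l x r then inorder l ++ x :: inorder r else [::].

(* The set T_m. *)
Definition inorder_labelled (m : nat) (T : bintree) : Prop :=
  inorder T = iota 1 m.

(* [T] is the binary search tree of the word [s]. *)
Fixpoint is_bst (T : bintree) (s : seq nat) : bool :=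
  match T, s with
  | Leaf, [::] => true
  | Node l x r, y :: s' =>
      [&& x == y, is_bst l [seq z <- s' | z < y]
                & is_bst r [seq z <- s' | y < z]]
  | _, _ => false
  end.

Definition R_word (n : nat) (s : seq nat) (k : nat) : seq (nat * nat) :=
  [seq x <- P n | leP_n (k, k.+1) x
                  && all (fun y => ~~ leP_n (y, y.+1) x) (take (index k s) s)].

(* R_word n (word s) k is the same for all s with binary search tree T
   (lemma R_tree_bst), and such an s exists (lemma bst_exists). *)
Definition R_tree (n : nat) (T : bintree) (k : nat) : seq (nat * nat) :=
  [seq x <- P n | [exists s : 'S_(n.-1),
                     is_bst T (word s) && (x \in R_word n (word s) k)]].

(* The maximum of R_{T,k}; the default value (0, 0) is not in P n. *)
Definition R_max (n : nat) (T : bintree) (k : nat) : nat * nat :=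
  head (0, 0) [seq m <- R_tree n T k | all (fun x => leP_n x m) (R_tree n T k)].

Definition wL (n : nat) (T : bintree) (k : nat) (w : 'S_n) : seq nat :=
  [seq x <- word w | (R_max n T k).1 <= x <= k].

Definition wR (n : nat) (T : bintree) (k : nat) (w : 'S_n) : seq nat :=
  [seq x <- word w | k.+1 <= x <= (R_max n T k).2].

(* [nth] counts from 0, hence the indices i - i_{T,k} and j - k - 1. *)
Definition I_tree (n : nat) (T : bintree) (w : 'S_n) : seq (nat * nat) :=
  [seq x <- P n |
     has (fun k => [&& (R_max n T k).1 <= x.1 <= k,
                       k.+1 <= x.2 <= (R_max n T k).2 &
                       before (word w) (nth 0 (wR T k w) (x.2 - k.+1))
                              (nth 0 (wL T k w) (x.1 - (R_max n T k).1))])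
         (iota 1 n.-1)].

Definition tree_le (n : nat) (T : bintree) (v w : 'S_n) : Prop :=
  {subset I_tree T v <= I_tree T w}.

Lemma mem_word (m : nat) (s : 'S_m) (k : nat) : (k \in word s) = (0 < k <= m).
Proof.
apply/mapP/idP => [[p _ ->] | /andP[k0 km]]; first by rewrite /= ltn_ord.
have km' : k.-1 < m by rewrite prednK.
by exists ((s^-1)%g (Ordinal km')); rewrite ?mem_enum // permKV /= prednK.
Qed.

Lemma all_take_filter (p Q : pred nat) (k : nat) (s : seq nat) :
    p k -> (forall y, ~~ p y -> Q y) ->
  all Q (take (index k s) s)
    = all Q (take (index k (filter p s)) (filter p s)).
Proof.
move=> pk pQ; elim: s => //= y s IHs.
case: eqVneq => [->|yk]; first by rewrite pk /= eqxx.
case: ifPn => [py | py] /=; first by rewrite (negPf yk) /= IHs.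
by rewrite pQ //= IHs.
Qed.

Lemma all_take_bst (T : bintree) (s t : seq nat) (k a b : nat) :
    is_bst T s -> is_bst T t -> k \in s -> k \in t -> a <= k < b ->
  all (fun y => ~~ (a <= y < b)) (take (index k s) s)
    = all (fun y => ~~ (a <= y < b)) (take (index k t) t).
Proof.
move=> + + + + /andP[ak kb].
elim: T s t => [|l IHl x r IHr] [|y s] [|z t] //=.
move=> /and3P[/eqP<- ls rs] /and3P[/eqP<- lt rt].
rewrite !inE; case: (ltngtP k x) => [kx|xk|-> _ _]; last by rewrite !take0.
- move=> /= ks kt; case: (boolP (a <= x < b)) => //= xab.
  have bx u : ~~ (u < x) -> ~~ (a <= u < b).
    rewrite -leqNgt => xu; apply: contra xab => /andP[_ ub].
    by rewrite (leq_trans ak (ltnW kx)) (leq_ltn_trans xu ub).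
  rewrite [LHS](@all_take_filter (fun u => u < x)) //.
  rewrite [RHS](@all_take_filter (fun u => u < x)) //.
  by apply: IHl => //; rewrite mem_filter kx.
- move=> /= ks kt; case: (boolP (a <= x < b)) => //= xab.
  have bx u : ~~ (x < u) -> ~~ (a <= u < b).
    rewrite -leqNgt => ux; apply: contra xab => /andP[au _].
    by rewrite (leq_trans au ux) (ltn_trans xk kb).
  rewrite [LHS](@all_take_filter (fun u => x < u)) //.
  rewrite [RHS](@all_take_filter (fun u => x < u)) //.
  by apply: IHr => //; rewrite mem_filter xk.
Qed.

Lemma mem_P (n : nat) (x : nat * nat) :
  (x \in P n) = [&& 0 < x.1, x.1 < x.2 & x.2 <= n].
Proof.
case: x => i j; rewrite mem_filter /=; apply/andP/and3P.
  by case=> ij /allpairsP[[u v] /= [+ + [? ?]]]; subst u v; rewrite !mem_iota;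
     move=> /andP[-> _] /andP[_ +]; rewrite add1n ltnS => ->.
case=> i0 ij jn; split=> //; apply/allpairsP; exists (i, j).
rewrite !mem_iota !add1n !ltnS i0 jn (leq_trans (ltnW ij) jn).
by rewrite (ltn_trans i0 ij).
Qed.

Lemma R_word_bst (n : nat) (T : bintree) (s t : 'S_(n.-1)) (k : nat) :
  is_bst T (word s) -> is_bst T (word t) ->
  R_word n (word s) k = R_word n (word t) k.
Proof.
move=> bs bt; apply: eq_in_filter => x; rewrite mem_P => /and3P[x0 x12 xn].
case: (boolP (leP_n _ _)) => //= /andP[/= xk kx].
have kn : 0 < k <= n.-1.
  rewrite (leq_trans x0 xk) -ltnS prednK ?(leq_trans kx xn) //.
  by rewrite (leq_trans _ xn) // (leq_ltn_trans _ x12).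
by apply: (all_take_bst bs bt); rewrite ?mem_word // xk.
Qed.

Lemma R_tree_bst (n : nat) (T : bintree) (s : 'S_(n.-1)) (k : nat) :
  is_bst T (word s) -> R_tree n T k = R_word n (word s) k.
Proof.
move=> bs; rewrite [RHS](_ : _ = [seq x <- P n | x \in R_word n (word s) k]).
  apply: eq_in_filter => x _; apply/existsP/idP => [[t /andP[bt]]|xR].
    by rewrite (R_word_bst k bs bt).
  by exists s; rewrite bs.
by apply: eq_in_filter => x xP; rewrite mem_filter xP andbT.
Qed.

Fixpoint preorder (T : bintree) : seq nat :=
  if T is Node l x r then x :: preorder l ++ preorder r else [::].

Lemma perm_preorder (T : bintree) : perm_eq (preorder T) (inorder T).
Proof.
elim: T => //= l IHl x r IHr.
by rewrite perm_sym perm_catC /= perm_cons perm_catC perm_sym perm_cat.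
Qed.

Lemma is_bst_preorder (T : bintree) :
  sorted ltn (inorder T) -> is_bst T (preorder T).
Proof.
elim: T => //= l IHl x r IHr.
rewrite (sorted_pairwise ltn_trans) pairwise_cat /= eqxx /=.
case/and4P=> lxr Hl xr Hr.
have lx y : y \in preorder l -> y < x.
  rewrite (perm_mem (perm_preorder l)) => yl.
  by have /allrelP := lxr; apply=> //; rewrite inE eqxx.
have rx y : y \in preorder r -> x < y.
  by rewrite (perm_mem (perm_preorder r)) => yr; have /allP := xr; apply.
rewrite !filter_cat.
have /all_filterP-> : all (fun z => z < x) (preorder l) by apply/allP.
have /all_filterP-> : all (fun z => x < z) (preorder r) by apply/allP.
have nil (p : pred nat) u : {in u, forall y, ~~ p y} -> filter p u = [::].
  move=> pu; apply/eqP; rewrite -[_ == _]negbK -has_filter.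
  by apply/hasPn.
rewrite !nil ?cats0 /=; first last.
- by move=> y /rx xy; rewrite -leqNgt ltnW.
- by move=> y /lx xy; rewrite -leqNgt ltnW.
by rewrite IHl ?IHr // (sorted_pairwise ltn_trans).
Qed.

Lemma word_exists (m : nat) (u : seq nat) :
  perm_eq u (iota 1 m) -> exists s : 'S_m, word s = u.
Proof.
move=> pu; have su : size u = m by rewrite (perm_size pu) size_iota.
have uu : uniq u by rewrite (perm_uniq pu) iota_uniq.
have hu (p : 'I_m) : 0 < nth 0 u p <= m.
  have : nth 0 u p \in iota 1 m by rewrite -(perm_mem pu) mem_nth ?su.
  by rewrite mem_iota add1n ltnS.
have hp (p : 'I_m) : (nth 0 u p).-1 < m by have /andP[? ?] := hu p; rewrite prednK.
pose f p := Ordinal (hp p).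
have fI : injective f.
  move=> p q /(congr1 val) /= /(congr1 succn).
  have /andP[p0 _] := hu p; have /andP[q0 _] := hu q.
  rewrite !prednK // => /eqP; rewrite nth_uniq ?su // => /eqP.
  exact: val_inj.
exists (perm fI); apply: (@eq_from_nth _ 0); rewrite size_map size_enum_ord //.
move=> i im; rewrite (nth_map (Ordinal im)) ?size_enum_ord // permE /=.
have /andP[? _] := hu (nth (Ordinal im) (enum 'I_m) i).
by rewrite prednK // nth_enum_ord.
Qed.

Lemma bst_exists (m : nat) (T : bintree) :
  inorder_labelled m T -> exists s : 'S_m, is_bst T (word s).
Proof.
move=> iT; have [|s ws] := @word_exists m (preorder T).
  by rewrite -iT perm_preorder.
by exists s; rewrite ws is_bst_preorder // iT iota_ltn_sorted.
Qed.

(* Main.v *)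
(* The subtree of T at node k carries an interval [lo, hi) of labels, and R_{T,k}
   is the rectangle lo <= i <= k < j <= hi; these rectangles are disjoint. Hence
   v <=_T w says that for every k the shuffle pattern of small letters [lo, k]
   and large letters [k + 1, hi] in v is dominated by the one in w.
   For the second implication, at the root k of T, v is a shuffle of its
   subwords of small and large letters, and these are compared by the two
   subtrees. Raise first the subwords: a Bruhat step in a subword is a Bruhat
   step of the whole word. Then raise the shuffle pattern, by exchanging
   adjacent letters, the small one before the large one. *)
Require Import Defs.
From mathcomp Require Import all_boot all_fingroup.
From mathcomp Require Import zify.

Set Implicit Arguments.
Unset Strict Implicit.
Unset Printing Implicit Defensive.

(** * Words of permutations and the relative order of their letters *)

Lemma size_word (n : nat) (w : 'S_n) : size (word w) = n.
Proof. by rewrite size_map size_enum_ord. Qed.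

Lemma nth_word (n : nat) (w : 'S_n) (p : 'I_n) : nth 0 (word w) p = (w p).+1.
Proof. by rewrite (nth_map p) ?size_enum_ord // nth_ord_enum. Qed.

Lemma word_inj (n : nat) : injective (@word n).
Proof.
move=> v w vw; apply/permP => p; apply/val_inj/succn_inj.
by rewrite -!nth_word vw.
Qed.

Lemma uniq_word (n : nat) (w : 'S_n) : uniq (word w).
Proof.
by rewrite map_inj_uniq ?enum_uniq // => p q [] /val_inj /perm_inj.
Qed.

Lemma perm_word_iota (n : nat) (w : 'S_n) : perm_eq (word w) (iota 1 n).
Proof.
apply: uniq_perm; rewrite ?uniq_word ?iota_uniq // => k.
by rewrite mem_word mem_iota add1n ltnS.
Qed.

Lemma before_filter (p : pred nat) (s : seq nat) (u v : nat) :
  p u -> p v -> before (filter p s) u v = before s u v.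
Proof.
move=> pu pv; rewrite /before; elim: s => //= z s IHs.
case: ifPn => pz /=; first by case: eqP => _; case: eqP => _ //; rewrite !ltnS.
have [-> ->] : (z == u) = false /\ (z == v) = false.
  by split; apply: contraNF pz => /eqP->.
by rewrite ltnS.
Qed.

(** Trades the position of a selected letter for a count over a prefix, so that two words can be
    compared prefix by prefix. *)
Lemma index_nth_filter (p : pred nat) (s : seq nat) (d m : nat) :
    uniq s -> m < count p s ->
  (index (nth 0 (filter p s) m) s < d) = (m < count p (take d s)).
Proof.
elim: s d m => //= z s IHs [|d] m /andP[zs us].
  by rewrite !ltn0.
rewrite /=; case: (boolP (p z)) => pz /=.
  case: m => [|m]; first by rewrite eqxx.
  rewrite !add1n ltnS => ms.
  have : nth 0 (filter p s) m \in filter p s by rewrite mem_nth ?size_filter.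
  rewrite mem_filter => /andP[_ ns].
  have /negPf-> : z != nth 0 (filter p s) m by apply: contraNneq zs => ->.
  by rewrite ltnS IHs.
rewrite !add0n => ms.
have : nth 0 (filter p s) m \in filter p s by rewrite mem_nth ?size_filter.
rewrite mem_filter => /andP[pn ns].
have /negPf-> : z != nth 0 (filter p s) m by apply: contraNneq pz => ->.
by rewrite ltnS IHs.
Qed.

Section Prefixes.
Variables (pL pR : pred nat) (s : seq nat) (a b : nat).
Hypotheses (us : uniq s) (aL : a < count pL s) (bR : b < count pR s).

Lemma before_prefix :
  reflect (exists d, b < count pR (take d s) /\ count pL (take d s) <= a)
          (before s (nth 0 (filter pR s) b) (nth 0 (filter pL s) a)).
Proof.
have dL d := index_nth_filter d us aL; have dR d := index_nth_filter d us bR.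
apply: (iffP idP) => [ba | [d [db da]]].
  (* The prefix stops just before the small letter of index [a]. *)
  exists (index (nth 0 (filter pL s) a) s).
  by split; [rewrite -dR | rewrite leqNgt -dL ltnn].
rewrite -dR in db; rewrite leqNgt -dL -leqNgt in da.
exact: leq_trans da.
Qed.

Lemma before_prefixN : (forall z, pL z -> ~~ pR z) ->
  reflect (exists d, a < count pL (take d s) /\ count pR (take d s) <= b)
          (~~ before s (nth 0 (filter pR s) b) (nth 0 (filter pL s) a)).
Proof.
move=> LR; have : nth 0 (filter pL s) a \in filter pL s.
  by rewrite mem_nth ?size_filter.
have : nth 0 (filter pR s) b \in filter pR s by rewrite mem_nth ?size_filter.
rewrite !mem_filter => /andP[Rb bs] /andP[La as_].
have dL d := index_nth_filter d us aL; have dR d := index_nth_filter d us bR.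
apply: (iffP idP) => [ba | [d [da db]]].
  (* This prefix includes the small letter of index [a]; disjointness of [pL] and [pR] keeps the
     large letter of index [b] from sitting at the same place. *)
  exists (index (nth 0 (filter pL s) a) s).+1.
  split; first by rewrite -dL.
  rewrite leqNgt -dR -leqNgt.
  move: ba; rewrite /before -leqNgt leq_eqVlt => /predU1P[] // e.
  by move: (LR _ La); rewrite (index_inj 0 as_ bs e) Rb.
rewrite -dL in da; rewrite leqNgt -dR -leqNgt in db.
by rewrite /before -leqNgt (leq_trans (ltnW da) db).
Qed.

End Prefixes.

Lemma exists_mem_countlt (p : pred nat) (s t : seq nat) :
    uniq t -> count p s < count p t ->
  exists z, [/\ p z, z \in t & z \notin s].
Proof.
move=> ut; rewrite -!size_filter => lt_st.
have /allPn[z] : ~~ all (fun z => z \in filter p s) (filter p t).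
  apply: contraL lt_st => /allP sub; rewrite -leqNgt.
  by apply: uniq_leq_size; rewrite ?filter_uniq.
rewrite !mem_filter => /andP[pz zt]; rewrite pz => zs.
by exists z.
Qed.

(* If the conclusion failed, a prefix of [t] would contain more small letters
   and fewer large letters than some prefix of [s]: a small letter gained and
   a large letter lost form an inversion of [s] but not of [t]. *)
Lemma before_nth_inversions (pL pR : pred nat) (s t : seq nat) (a b : nat) :
    uniq s -> perm_eq s t -> (forall z, pL z -> ~~ pR z) ->
    a < count pL s -> b < count pR s ->
    (forall x y, x \in s -> y \in s -> pL x -> pR y ->
       before s y x -> before t y x) ->
  before s (nth 0 (filter pR s) b) (nth 0 (filter pL s) a) ->
  before t (nth 0 (filter pR t) b) (nth 0 (filter pL t) a).
Proof.
move=> us st LR aL bR inv /(before_prefix us aL bR)[d [bd da]].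
have ut : uniq t by rewrite -(perm_uniq st).
apply/negPn/negP => /(before_prefixN ut); rewrite -!(seq.permP st).
case=> // e [ae eb].
have [x [Lx xt xs]] :=
  exists_mem_countlt (take_uniq e ut) (leq_ltn_trans da ae).
have [y [Ry ys yt]] :=
  exists_mem_countlt (take_uniq d us) (leq_ltn_trans eb bd).
have xt' := mem_take xt; have ys' := mem_take ys.
have xs' : x \in s by rewrite (perm_mem st).
have yt' : y \in t by rewrite -(perm_mem st).
rewrite in_take // in xt; rewrite in_take // in ys.
rewrite in_take // -leqNgt in xs.
rewrite in_take // -leqNgt in yt.
have := inv x y xs' ys' Lx Ry (leq_trans ys xs).
by rewrite /before ltnNge ltnW // (leq_trans xt yt).
Qed.

(** * The Bruhat order on arbitrary words, hence also on subwords *)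

Inductive bruhat_word : seq nat -> seq nat -> Prop :=
| bruhat_word_refl s : bruhat_word s s
| bruhat_word_step A x B y C t : x < y ->
    bruhat_word (A ++ y :: B ++ x :: C) t ->
    bruhat_word (A ++ x :: B ++ y :: C) t.

Lemma bruhat_word_trans (s t u : seq nat) :
  bruhat_word s t -> bruhat_word t u -> bruhat_word s u.
Proof.
elim=> [//|A x B y C r xy _ IH] /IH; exact: bruhat_word_step.
Qed.

Lemma bruhat_word_cons (z : nat) (s t : seq nat) :
  bruhat_word s t -> bruhat_word (z :: s) (z :: t).
Proof.
elim=> [r|A x B y C r xy _ IH]; first exact: bruhat_word_refl.
exact: (@bruhat_word_step (z :: A)).
Qed.

Lemma filter_eq_cat (p : pred nat) (s A C : seq nat) (x : nat) :
    filter p s = A ++ x :: C ->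
  exists A' C', [/\ s = A' ++ x :: C', filter p A' = A, filter p C' = C & p x].
Proof.
elim: s A => [[]//|z s IHs] A /=; case: ifPn => pz.
  case: A => [[<- <-]|z' A [<- /IHs[A' [C' [-> <- <- px]]]]].
    by exists [::], s.
  by exists (z :: A'), C'; rewrite /= pz.
by case/IHs=> A' [C' [-> <- <- px]]; exists (z :: A'), C'; rewrite /= (negPf pz).
Qed.

(** The exchanged letters both satisfy [p], so the pattern [map p] and the other letters stay put.
    Both facts are kept so that the complementary subword can be raised next and the pattern
    last. *)
Lemma bruhat_word_lift (p : pred nat) (u u' s : seq nat) :
    bruhat_word u u' -> filter p s = u ->
  exists s', [/\ bruhat_word s s', filter p s' = u',
    filter (predC p) s' = filter (predC p) s & map p s' = map p s].
Proof.
move=> uu'; elim: uu' s => [r|A x B y C r xy _ IH] s.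
  by move=> <-; exists s; split=> //; exact: bruhat_word_refl.
case/filter_eq_cat=> A' [D [-> fA /filter_eq_cat[B' [C' [-> fB fC py]]] px]].
have [|s' [bs fs fs' ms]] := IH (A' ++ y :: B' ++ x :: C').
  by rewrite filter_cat /= filter_cat /= px py fA fB fC.
exists s'; split=> //; first exact: bruhat_word_step.
  by rewrite fs' !filter_cat /= !filter_cat /= px py.
by rewrite ms !map_cat /= !map_cat /= px py.
Qed.

Lemma bruhat_word_front (A C : seq nat) (y : nat) :
  all (fun z => z < y) A -> bruhat_word (A ++ y :: C) (y :: A ++ C).
Proof.
elim: A => [|x A IHA] /=; first by move=> _; exact: bruhat_word_refl.
case/andP=> xy /IHA/(bruhat_word_cons x)/bruhat_word_trans; apply.
exact: (@bruhat_word_step [::] x [::] y _ _ xy (bruhat_word_refl _)).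
Qed.

(** Induction on [t]. A small first letter of [t] must also open [s], by dominance on prefixes of
    length 1. A large one is the first large letter of [s], and [bruhat_word_front] moves it over
    the small letters [A] before it. *)
Lemma bruhat_word_shuffle (p : pred nat) (s t : seq nat) :
    {in s &, forall x y, p x -> ~~ p y -> x < y} ->
    filter p s = filter p t -> filter (predC p) s = filter (predC p) t ->
    (forall d, count p (take d t) <= count p (take d s)) ->
  bruhat_word s t.
Proof.
elim: t s => [|z t IHt] s ps.
  move=> fs fs' _; suff -> : s = [::] by exact: bruhat_word_refl.
  by apply/nilP; rewrite /nilp -(count_predC p) -!size_filter fs fs'.
have [pz|pz] := boolP (p z).
  case: s ps => [|z' s] ps /=; rewrite pz => fs fs' dom //.
  have pz' : p z' by move: (dom 1); rewrite /= pz !take0; case: (p z').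
  move: fs fs'; rewrite pz' /= => -[e fs] fs'; subst z'.
  apply: bruhat_word_cons; apply: IHt => // [x y xs ys|d].
    by apply: ps; rewrite inE ?xs ?ys orbT.
  by move: (dom d.+1); rewrite /= pz leq_add2l.
move=> /= fs fs' dom; rewrite (negPf pz) /= in fs fs'.
case: (@filter_eq_cat _ _ [::] _ _ fs') => A [C [es fA fC _]].
have pA : all p A.
  by apply: contraT; rewrite -has_predC has_filter fA.
subst s; apply: (bruhat_word_trans (bruhat_word_front _ _)).
  apply/allP => x xA; apply: ps => //; rewrite ?mem_cat ?xA ?mem_head ?orbT //.
  exact: (allP pA).
apply/bruhat_word_cons/IHt => [x y xs ys|||d].
- apply: ps; rewrite mem_cat inE; move: xs ys; rewrite !mem_cat.
    by case/orP=> ->; rewrite ?orbT.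
  by move=> _; case/orP=> ->; rewrite ?orbT.
- by rewrite -fs !filter_cat /= (negPf pz).
- by rewrite filter_cat fA fC.
(* Dominance survives the move: up to the length of [A] the prefix has only small letters; beyond
   it, the old prefix of length [d + 1] contains the moved letter and has the same small letters. *)
case: (leqP d (size A)) => dA.
  rewrite takel_cat //; have : all p (take d A).
    by apply/allP => x /mem_take; exact: (allP pA).
  rewrite all_count => /eqP->.
  rewrite (leq_trans (count_size _ _)) // (size_takel dA).
  by rewrite size_take_min geq_minl.
move: (dom d.+1); rewrite /= (negPf pz) add0n !take_cat.
have [-> ->] : (d.+1 < size A) = false /\ (d < size A) = false by lia.
rewrite (subSn (ltnW dA)) /=.
by rewrite !count_cat /= (negPf pz).
Qed.

(** If a prefix of [t] has more small letters than the prefix of [s] of the same length, it has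
    fewer large ones. The two lesser counts are then the indices of a pair with the large letter
    first in [s] but not in [t]. *)
Lemma count_take_before (p : pred nat) (s t : seq nat) :
    uniq s -> perm_eq s t ->
    (forall a b, a < count p s -> b < count (predC p) s ->
       before s (nth 0 (filter (predC p) s) b) (nth 0 (filter p s) a) ->
       before t (nth 0 (filter (predC p) t) b) (nth 0 (filter p t) a)) ->
  forall d, count p (take d t) <= count p (take d s).
Proof.
move=> us st bst d; rewrite leqNgt; apply/negP => lt_st.
have ut : uniq t by rewrite -(perm_uniq st).
have le_take q (r : seq nat) : count q (take d r) <= count q r.
  by rewrite -{2}(cat_take_drop d r) count_cat leq_addr.
have := count_predC p (take d s); have := count_predC p (take d t).
rewrite !size_take_min (perm_size st) => <- e.
have lt_ts : count (predC p) (take d t) < count (predC p) (take d s) by lia.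
have aL := leq_trans lt_st (le_take p t).
have bR := leq_trans lt_ts (le_take (predC p) s).
have aL' := aL; have bR' := bR.
rewrite -(seq.permP st) in aL'; rewrite (seq.permP st) in bR'.
have /bst : before s (nth 0 (filter (predC p) s) (count (predC p) (take d t)))
    (nth 0 (filter p s) (count p (take d s))).
  by apply/before_prefix => //; exists d.
move=> /(_ aL' bR); apply/negP/before_prefixN => //; last by exists d.
by move=> z /= ->.
Qed.

(** * Inversion numbers and Bruhat steps of permutations *)

Fixpoint inv_count (s : seq nat) : nat :=
  if s is z :: s' then count (fun i => i < z) s' + inv_count s' else 0.

(** The inversions that involve a third letter do not decrease in number, and the pair itself
    becomes an inversion. *)
Lemma inv_count_swap (A B C : seq nat) (x y : nat) : x < y ->
  inv_count (A ++ x :: B ++ y :: C) < inv_count (A ++ y :: B ++ x :: C).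
Proof.
move=> xy; elim: A => [|z A IHA] /=; last first.
  rewrite -addnS leq_add // leq_eqVlt; apply/orP; left; apply/eqP.
  by rewrite !count_cat /= !count_cat /=; lia.
elim: B => [|z B IHB] /=; first by rewrite xy; lia.
by move: IHB; rewrite !count_cat /=; lia.
Qed.

Lemma inv_count_sum (s : seq nat) : uniq s ->
  inv_count s = \sum_(j <- s) \sum_(i <- s) (i < j) && before s j i.
Proof.
elim: s => [|z s IHs] /= => [_|/andP[zs us]]; first by rewrite big_nil.
rewrite big_cons big_cons ltnn add0n IHs //; congr (_ + _).
  rewrite -sum1_count big_mkcond; apply: eq_big_seq => i ins.
  rewrite /before /= eqxx; case: (eqVneq z i) => [e|_].
    by rewrite e ins in zs.
  by case: ltnP.
apply: eq_big_seq => j js; rewrite big_cons /before /= eqxx ltn0 andbF add0n.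
apply: eq_big_seq => i ins.
have [-> ->] : (z == i) = false /\ (z == j) = false.
  by split; apply: contraNF zs => /eqP->.
by rewrite ltnS.
Qed.

Lemma size_inversions (n : nat) (w : 'S_n) :
  size (inversions w) = inv_count (word w).
Proof.
rewrite inv_count_sum ?uniq_word // size_filter -sum1_count big_mkcond.
rewrite big_filter big_mkcond big_allpairs exchange_big /=.
rewrite -(perm_big _ (perm_word_iota w)) /=; apply: eq_bigr => j _.
rewrite -(perm_big _ (perm_word_iota w)) /=; apply: eq_bigr => i _.
by case: ifP => //= _; case: before.
Qed.

Lemma bruhat_le_word (n : nat) (s t : seq nat) (v w : 'S_n) :
  bruhat_word s t -> word v = s -> word w = t -> bruhat_le v w.
Proof.
move=> st; elim: st v => [r|A x B y C r xy _ IH] v vs wt.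
  by rewrite (@word_inj _ v w) ?vs //; exact: connect0.
have := size_word v; rewrite vs size_cat /= size_cat /= => sz.
(* Positions, counted from 0, of [x] and of [y] in the word. *)
have ha : size A < n by lia.
have hb : size A + (size B).+1 < n by lia.
pose a := Ordinal ha; pose b := Ordinal hb.
have e : word (tperm a b * v)%g = A ++ y :: B ++ x :: C.
  apply: (@eq_from_nth _ 0) => [|i].
    by rewrite size_word size_cat /= size_cat.
  rewrite size_word => hi; rewrite (nth_word _ (Ordinal hi)) permM -nth_word vs.
  case: tpermP => [[->]|[->]|/eqP ia /eqP ib] /=.
  - by rewrite !nth_cat ltnn subnn ltnNge leq_addr /= addKn /= nth_cat ltnn subnn.
  - by rewrite !nth_cat ltnn subnn ltnNge leq_addr /= addKn /= nth_cat ltnn subnn.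
  rewrite -val_eqE /= in ia; rewrite -val_eqE /= in ib.
  rewrite !nth_cat; case: ltnP => // Ai.
  have -> : i - size A = (i - size A).-1.+1 by lia.
  rewrite /= !nth_cat; case: ltnP => // Bi.
  have -> : (i - size A).-1 - size B = ((i - size A).-1 - size B).-1.+1 by lia.
  by [].
apply: connect_trans (IH _ e wt); apply/connect1/andP; split.
  by apply/existsP; exists a; apply/existsP; exists b.
by rewrite !size_inversions e vs inv_count_swap.
Qed.

(** * Binary trees and their rectangles *)

Fixpoint tree_on (T : bintree) (a b : nat) : bool :=
  if T is Node l x r then [&& a <= x < b, tree_on l a x & tree_on r x.+1 b]
  else a == b.

Lemma tree_on_inorder (T : bintree) (a m : nat) :
  inorder T = iota a m -> tree_on T a (a + m).
Proof.
elim: T a m => [|l IHl x r IHr] a m /=.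
  by case: m => //= _; rewrite addn0.
move=> e; have sm : size (inorder l) < m.
  by rewrite -(size_iota a m) -e size_cat /= addnS ltnS leq_addr.
have := e; rewrite -{1}(subnKC (ltnW sm)) iotaD => /eqP.
rewrite eqseq_cat ?size_iota // => /andP[/eqP el].
have -> : m - size (inorder l) = (m - (size (inorder l)).+1).+1 by lia.
move=> /eqP[ex /IHr er]; have := IHl _ _ el; rewrite -ex => ->.
move: er; rewrite -ex.
have -> : x.+1 + (m - (size (inorder l)).+1) = a + m by lia.
by move=> ->; lia.
Qed.

(* The triples (i_{T,k}, k, j_{T,k}): the subtree at node k carries the labels
   in [i_{T,k}, j_{T,k}). *)
Fixpoint rects (T : bintree) (a b : nat) : seq (nat * nat * nat) :=
  if T is Node l x r then (a, x, b) :: rects l a x ++ rects r x.+1 b else [::].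

Lemma rects_bounds (T : bintree) (a b lo k hi : nat) :
  tree_on T a b -> (lo, k, hi) \in rects T a b -> [&& a <= lo, lo <= k, k < hi & hi <= b].
Proof.
elim: T a b => //= l IHl x r IHr a b /and3P[axb onl onr].
rewrite inE mem_cat => /orP[/eqP[-> -> ->]|/orP[/(IHl _ _ onl)|/(IHr _ _ onr)]];
  lia.
Qed.

Lemma mem_rects (T : bintree) (a b k : nat) :
  k \in inorder T -> exists lo hi, (lo, k, hi) \in rects T a b.
Proof.
elim: T a b => //= l IHl x r IHr a b.
rewrite mem_cat inE => /or3P[/(IHl a x)|/eqP->|/(IHr x.+1 b)].
- by case=> lo [hi h]; exists lo, hi; rewrite inE mem_cat h orbT.
- by exists a, b; rewrite mem_head.
by case=> lo [hi h]; exists lo, hi; rewrite inE mem_cat h !orbT.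
Qed.

(** Rectangles of the left subtree have [j <= x], those of the right one [x < i], and that of the
    root [x] has [i <= x < j]. *)
Lemma rects_disjoint (T : bintree) (a b lo k hi lo' k' hi' i j : nat) :
    tree_on T a b -> (lo, k, hi) \in rects T a b ->
    (lo', k', hi') \in rects T a b ->
    lo <= i <= k -> k < j <= hi -> lo' <= i <= k' -> k' < j <= hi' ->
  k = k'.
Proof.
elim: T a b => //= l IHl x r IHr a b /and3P[axb onl onr].
rewrite !inE !mem_cat.
case/or3P=> [/eqP[-> -> ->]|h|h]; case/or3P=> [/eqP[-> -> ->]|h'|h'] //;
  try (by move=> *; apply: (IHl _ _ onl h h'); lia);
  try (by move=> *; apply: (IHr _ _ onr h h'); lia);
  repeat match goal with
  | H : is_true (_ \in rects l _ _) |- _ => move/(rects_bounds onl): H => H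
  | H : is_true (_ \in rects r _ _) |- _ => move/(rects_bounds onr): H => H
  end; lia.
Qed.

(** Follow the path from the root to [k]. If [k] is in the left subtree of [x], then [x] avoids [i,
    j) iff [j <= x], which is the bound the induction asks for; letters from [x] on are then
    harmless and can be filtered out. The right side is symmetric, with [x < i]. *)
Lemma all_take_rect (T : bintree) (s : seq nat) (a b lo k hi i j : nat) :
    tree_on T a b -> is_bst T s -> (lo, k, hi) \in rects T a b ->
    a <= i <= k -> k < j <= b ->
  all (fun y => ~~ (i <= y < j)) (take (index k s) s) = (lo <= i) && (j <= hi).
Proof.
elim: T s a b => //= l IHl x r IHr [|y s] a b //= /and3P[axb onl onr].
case/and3P=> /eqP<- bl br; rewrite inE mem_cat => /or3P[/eqP[-> -> ->]|h|h].
- by rewrite eqxx /=; lia.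
- have B := rects_bounds onl h => ik kj.
  have -> : (x == k) = false by lia.
  rewrite /=; case: (leqP j x) => jx; last by rewrite (_ : i <= x); lia.
  rewrite andbF /= (@all_take_filter (fun u => u < x)); try lia.
    by rewrite (IHl _ _ _ onl bl h); lia.
have B := rects_bounds onr h => ik kj.
have -> : (x == k) = false by lia.
rewrite /=; case: (leqP i x) => ix; first by rewrite (_ : x < j); lia.
rewrite /= (@all_take_filter (fun u => x < u)); try lia.
  by rewrite (IHr _ _ _ onr br h); lia.
Qed.

(** Label [k] separates the letters [k] and [k + 1], so labels in [a, b) go with letters in the
    closed interval [a, b], and a leaf leaves at most one letter. *)
Lemma bruhat_word_rects (T : bintree) (a b : nat) (s t : seq nat) :
    tree_on T a b -> uniq s -> perm_eq s t ->
    {in s, forall z, a <= z <= b} ->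
    (forall lo k hi, (lo, k, hi) \in rects T a b -> forall d,
       count (fun z => z <= k) (take d (filter (fun z => lo <= z <= hi) t))
       <= count (fun z => z <= k) (take d (filter (fun z => lo <= z <= hi) s))) ->
  bruhat_word s t.
Proof.
elim: T a b s t => [|l IHl x r IHr] a b s t /=.
  move=> /eqP<- us st sa _; suff -> : s = t by exact: bruhat_word_refl.
  rewrite perm_sym in st; apply/esym/(perm_small_eq _ st).
  rewrite (@uniq_leq_size _ s [:: a]) // => z /sa.
  by rewrite inE; lia.
move=> /and3P[axb onl onr] us st sab dom.
have tab : {in t, forall z, a <= z <= b}.
  by move=> z; rewrite -(perm_mem st); exact: sab.
pose p z := z <= x.
have fp (q c : pred nat) u : (forall z, c z -> q z) ->
    filter c (filter q u) = filter c u.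
  move=> cq; rewrite -filter_predI; apply: eq_filter => z /=.
  by case: (boolP (c z)) => // /cq->.
have bl : bruhat_word (filter p s) (filter p t).
  apply: (IHl a x) => //; rewrite ?filter_uniq ?perm_filter //.
    by move=> z; rewrite mem_filter /p => /andP[zx /sab]; lia.
  move=> lo k hi h d; have B := rects_bounds onl h.
  rewrite !fp; try by rewrite /p; lia.
  by apply: dom; rewrite inE mem_cat h orbT.
have br : bruhat_word (filter (predC p) s) (filter (predC p) t).
  apply: (IHr x.+1 b) => //; rewrite ?filter_uniq ?perm_filter //.
    by move=> z; rewrite mem_filter /p /= => /andP[zx /sab]; lia.
  move=> lo k hi h d; have B := rects_bounds onr h.
  rewrite !fp; try by rewrite /p /=; lia.
  by apply: dom; rewrite inE mem_cat h !orbT.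
have [s1 [bs1 fs1 gs1 ms1]] := bruhat_word_lift bl erefl.
(* The first lift kept the large letters of [s], so the second can start from [s1]. *)
rewrite -gs1 in br.
have [s2 [bs2 fs2 gs2 ms2]] := bruhat_word_lift br erefl.
have pp u : filter (predC (predC p)) u = filter p u.
  by apply: eq_filter => z /=; rewrite negbK.
rewrite !pp fs1 in gs2.
apply: (bruhat_word_trans bs1 (bruhat_word_trans bs2 _)).
apply: (@bruhat_word_shuffle p) => // [y z _ _|d]; first by rewrite /p; lia.
(* Neither lift changes the shuffle pattern, so dominance at the root can still be read off [s]. *)
have ms : map p s2 = map p s.
  rewrite -ms1; apply: (inj_map negb_inj).
  by rewrite -!map_comp; exact: ms2.
have cm u : count p (take d u) = count id (take d (map p u)).
  by rewrite -map_take count_map; apply: eq_count.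
rewrite [X in _ <= X]cm ms -cm.
(* The root rectangle takes in all letters: the filter on [a, b] is the identity. *)
have := dom a x b (mem_head _ _) d.
have /all_filterP-> : all (fun z => a <= z <= b) t by apply/allP.
by have /all_filterP-> : all (fun z => a <= z <= b) s by apply/allP.
Qed.

(** * The sets R_{T,k} as rectangles, and the two implications *)

Section Rectangles.
Variables (n : nat) (T : bintree).
Hypotheses (hn : 1 <= n) (hT : inorder_labelled n.-1 T).

Lemma tree_on_labelled : tree_on T 1 n.
Proof. by have := tree_on_inorder hT; rewrite add1n prednK. Qed.

Lemma mem_R_tree (lo k hi : nat) (x : nat * nat) : (lo, k, hi) \in rects T 1 n ->
  (x \in R_tree n T k) = (lo <= x.1 <= k) && (k < x.2 <= hi).
Proof.
move=> h; have [s bs] := bst_exists hT.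
have B := rects_bounds tree_on_labelled h.
rewrite (R_tree_bst _ bs) mem_filter mem_P; case: x => i j /=.
rewrite {1}/leP_n /=; case: (boolP (i <= k)) => ik /=; last by lia.
case: (boolP (k < j)) => kj /=; last by lia.
case: (boolP (0 < i)) => i0 /=; last by lia.
case: (boolP (j <= n)) => jn /=; last by lia.
rewrite (eq_all (a2 := fun y => ~~ (i <= y < j))) //.
by rewrite (all_take_rect tree_on_labelled bs h); lia.
Qed.

Lemma R_max_rect (lo k hi : nat) : (lo, k, hi) \in rects T 1 n ->
  R_max n T k = (lo, hi).
Proof.
move=> h; have B := rects_bounds tree_on_labelled h.
have maxP : (lo, hi) \in R_tree n T k by rewrite (mem_R_tree _ h) /=; lia.
rewrite /R_max; set M := filter _ _.
(* Membership shows that [head] does not return its default; uniqueness of the maximum then settles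
   what it returns. *)
have : (lo, hi) \in M.
  rewrite mem_filter maxP andbT; apply/allP => x.
  by rewrite (mem_R_tree _ h) /leP_n /=; lia.
have : {in M, forall m, m = (lo, hi)}; last first.
  by case: M => // m M eM _; rewrite [LHS](eM m) // mem_head.
move=> [i j]; rewrite mem_filter => /andP[/allP/(_ _ maxP)].
by rewrite (mem_R_tree _ h) /leP_n /= => *; congr pair; lia.
Qed.

Lemma count_word_interval (w : 'S_n) (lo hi : nat) : 0 < lo -> hi <= n ->
  count (fun z => lo <= z <= hi) (word w) = hi.+1 - lo.
Proof.
move=> lo0 hin; rewrite -size_filter -(size_iota lo (hi.+1 - lo)).
apply/perm_size/uniq_perm; rewrite ?filter_uniq ?uniq_word ?iota_uniq // => z.
by rewrite mem_filter mem_word mem_iota; lia.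
Qed.

(** The bounds at node [k] depend on [T] only, so the same [k] serves [v] and [w], and only
    inversions between a letter at most [k] and one above [k] are compared. *)
Lemma weak_le_tree_le (v w : 'S_n) : weak_le v w -> tree_le T v w.
Proof.
move=> vw [i j]; rewrite !mem_filter => /andP[/hasP[k kT /= K] ->].
rewrite andbT; apply/hasP; exists k => //=.
have [|lo [hi h]] := @mem_rects T 1 n k; first by rewrite hT.
have B := rects_bounds tree_on_labelled h.
move: K; rewrite /wL /wR (R_max_rect h) /= => /and3P[ik kj].
rewrite ik kj /=; apply: before_nth_inversions; rewrite ?uniq_word //.
- by rewrite (permPl (perm_word_iota v)) perm_sym perm_word_iota.
- by move=> z /=; lia.
- by rewrite count_word_interval; lia.
- by rewrite count_word_interval; lia.
move=> x y /=; rewrite !mem_word => xn yn xk ky yx.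
have /vw : (x, y) \in inversions v by rewrite mem_filter yx mem_P /=; lia.
by rewrite mem_filter => /andP[].
Qed.

(** [I_tree] is a union over all nodes, so membership for [w] yields only some node [k'];
    disjointness of the rectangles forces [k' = k]. *)
Lemma tree_le_before (v w : 'S_n) (lo k hi i j : nat) : tree_le T v w ->
    (lo, k, hi) \in rects T 1 n -> lo <= i <= k -> k < j <= hi ->
    before (word v) (nth 0 (wR T k v) (j - k.+1)) (nth 0 (wL T k v) (i - lo)) ->
  before (word w) (nth 0 (wR T k w) (j - k.+1)) (nth 0 (wL T k w) (i - lo)).
Proof.
move=> vw h ik kj bv; have B := rects_bounds tree_on_labelled h.
have kT : k \in iota 1 n.-1 by rewrite mem_iota; lia.
have /vw : (i, j) \in I_tree T v.
  have ijn : [&& 0 < i, i < j & j <= n] by lia.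
  rewrite mem_filter mem_P /= ijn andbT; apply/hasP; exists k => //=.
  by rewrite (R_max_rect h) /= ik kj.
rewrite mem_filter => /andP[/hasP[k' k'T /= +] _].
have [|lo' [hi' h']] := @mem_rects T 1 n k'; first by rewrite hT.
rewrite (R_max_rect h') /= => /and3P[ik' kj' bw].
have e := rects_disjoint tree_on_labelled h h' ik kj ik' kj'.
subst k'; have [elo _] : (lo, hi) = (lo', hi').
  by rewrite -(R_max_rect h) (R_max_rect h').
by rewrite elo.
Qed.

Lemma tree_le_bruhat_le (v w : 'S_n) : tree_le T v w -> bruhat_le v w.
Proof.
move=> vw; apply: (@bruhat_le_word n (word v) (word w)) => //.
have pvw : perm_eq (word v) (word w).
  by rewrite (permPl (perm_word_iota v)) perm_sym perm_word_iota.
apply: (bruhat_word_rects tree_on_labelled) => //.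
- exact: uniq_word.
- by move=> z; rewrite mem_word.
move=> lo k hi h; have B := rects_bounds tree_on_labelled h.
have fL (u : 'S_n) : filter (fun z => z <= k) (filter (fun z => lo <= z <= hi) (word u))
    = wL T k u.
  by rewrite /wL (R_max_rect h) -filter_predI; apply: eq_filter => z /=; lia.
have fR (u : 'S_n) : filter (predC (fun z => z <= k))
    (filter (fun z => lo <= z <= hi) (word u)) = wR T k u.
  by rewrite /wR (R_max_rect h) -filter_predI; apply: eq_filter => z /=; lia.
have sL (u : 'S_n) : size (wL T k u) = k.+1 - lo.
  by rewrite /wL (R_max_rect h) size_filter count_word_interval /=; lia.
have sR (u : 'S_n) : size (wR T k u) = hi - k.
  by rewrite /wR (R_max_rect h) size_filter count_word_interval /=; lia.
apply: count_take_before; rewrite ?filter_uniq ?uniq_word ?perm_filter //.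
move=> a b; rewrite -!size_filter !fL !fR sL sR => ha hb.
have hL (u : 'S_n) : lo <= nth 0 (wL T k u) a <= hi.
  have : nth 0 (wL T k u) a \in wL T k u by rewrite mem_nth ?sL.
  by rewrite mem_filter (R_max_rect h) /=; lia.
have hR (u : 'S_n) : lo <= nth 0 (wR T k u) b <= hi.
  have : nth 0 (wR T k u) b \in wR T k u by rewrite mem_nth ?sR.
  by rewrite mem_filter (R_max_rect h) /=; lia.
(* Both letters lie in [lo, hi], so the subword and the whole word order them alike. *)
rewrite !(@before_filter (fun z => lo <= z <= hi)) //.
(* The shifts by [lo] and [k.+1] cancel the subtractions in the indices of [I_tree]. *)
have := @tree_le_before v w lo k hi (a + lo) (b + k.+1) vw h.
by rewrite !addnK; apply; lia.
Qed.

End Rectangles.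

Theorem proposition3p9 (n : nat) (hn : 1 <= n) (T : bintree)
    (hT : inorder_labelled n.-1 T) (v w : 'S_n) :
  (weak_le v w -> tree_le T v w) /\ (tree_le T v w -> bruhat_le v w).
Proof.
split; first exact: weak_le_tree_le.
exact: tree_le_bruhat_le.
Qed.
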